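(* Let $k\ge 1$ be an integer. Let $B_{2k}$ be the set of all positive integers whose Chung-Graham decomposition has $F_{2k}$ or $2F_{2k}$ as its smallest summand (i.e., $F_{2k}$ is the smallest Fibonacci number appearing with nonzero coefficient), and let $q(j)$ denote the $j$th smallest element of $B_{2k}$ ($j\ge 1$). Then for every $j\ge 2$, $F_{2k}\in Z(q(j))$ if and only if $\mathcal{S}(j-1)=A$. Moreover, $\min Z(q(j))\ge F_{2k-2}$ for all $j\ge 1$.
   Context: Fibonacci numbers: $F_0=0$, $F_1=1$, $F_{n+2}=F_{n+1}+F_n$. Zeckendorf decomposition: every positive integer $n$ is uniquely a sum $\sum_{i\ge 2} a_iF_i$ with $a_i\in\{0,1\}$, finitely many nonzero, and no two consecutive $a_i,a_{i+1}$ both equal to $1$. $Z(n)$ is the set of all Fibonacci numbers appearing in the Zeckendorf decomposition of $n$. Chung-Graham decomposition: every positive integer $n$ is uniquely a sum $\sum_{i\ge 1}c_iF_{2i}$ with $c_i\in\{0,1,2\}$, finitely many nonzero, such that whenever $c_{i_1}=c_{i_2}=2$ with $i_1<i_2$, there is $j$ with $i_1<j<i_2$ and $c_j=0$. Golden string: define finite strings over $\{A,B\}$ by $S_1=B$, $S_2=BA$, and $S_n=S_{n-1}:S_{n-2}$ (concatenation) for $n\ge 3$. Then $|S_n|=F_{n+1}$, each $S_n$ is a prefix of $S_{n+1}$, and $\mathcal{S}=BABBABABBABBA\ldots$ is the infinite string having every $S_n$ as a prefix; $\mathcal{S}(i)$ is its $i$th letter ($i\ge 1$). *)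

(* Defs.v *)
From mathcomp Require Import all_boot.
From Stdlib Require Import ClassicalEpsilon.

Set Implicit Arguments.
Unset Strict Implicit.
Unset Printing Implicit Defensive.

Fixpoint fib (n : nat) : nat :=
  match n with
  | 0 => 0
  | m.+1 => match m with
            | 0 => 1
            | p.+1 => fib m + fib p
            end
  end.

Definition zeckendorf (a : nat -> nat) (n : nat) : Prop :=
  exists N : nat,
    [/\ forall i, a i != 0 -> 2 <= i < N,
        forall i, a i <= 1,
        forall i, ~ (a i = 1 /\ a i.+1 = 1)
      & n = \sum_(2 <= i < N) a i * fib i].

(* The elements of Z n are the values of the Fibonacci numbers, not their
   indices. *)
Definition Z (n : nat) : nat -> Prop :=
  fun f => exists a : nat -> nat,
    zeckendorf a n /\ exists i : nat, a i = 1 /\ f = fib i.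

Definition chung_graham (c : nat -> nat) (n : nat) : Prop :=
  exists N : nat,
    [/\ forall i, c i != 0 -> 1 <= i < N,
        forall i, c i <= 2,
        forall i1 i2, i1 < i2 -> c i1 = 2 -> c i2 = 2 ->
          exists j, i1 < j < i2 /\ c j = 0
      & n = \sum_(1 <= i < N) c i * fib (2 * i)].

(* B k stands for B_{2k}. *)
Definition B (k : nat) : nat -> Prop :=
  fun n => 0 < n /\
    exists c : nat -> nat,
      [/\ chung_graham c n, c k != 0 & forall i, i < k -> c i = 0].

Definition is_min (P : nat -> Prop) (m : nat) : Prop :=
  P m /\ forall x, P x -> m <= x.

(* For j >= 1, q j is the j-th smallest element of P; the value q 0 is
   irrelevant. *)
Definition increasing_enum (P : nat -> Prop) (q : nat -> nat) : Prop :=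
  (forall i j, 1 <= i -> i < j -> q i < q j) /\
  (forall n, P n <-> exists j, 1 <= j /\ q j = n).

Inductive letter : Set := LA | LB.

(* The strings S_n for n >= 1; the value at 0 is junk. *)
Fixpoint gstring (n : nat) : seq letter :=
  match n with
  | 0 => [::]
  | m.+1 => match m with
            | 0 => [:: LB]
            | p.+1 => match p with
                      | 0 => [:: LB; LA]
                      | _.+1 => gstring m ++ gstring p
                      end
            end
  end.

(* The i-th letter (i >= 1) of the infinite golden string, read off S_i, which
   is long enough since |S_i| = F_{i+1} >= i; golden_prefix shows that every
   S_n is a prefix of the infinite string. *)
Definition golden (i : nat) : letter := nth LB (gstring i) i.-1.

Lemma fibSS n : fib n.+2 = fib n.+1 + fib n.
Proof. by []. Qed.

Lemma gstringSSS n : gstring n.+3 = gstring n.+2 ++ gstring n.+1.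
Proof. by []. Qed.

Lemma size_gstring n : 1 <= n -> size (gstring n) = fib n.+1.
Proof.
case: n => // n _.
suff [] : size (gstring n.+1) = fib n.+2 /\ size (gstring n.+2) = fib n.+3 by [].
elim: n => [//|n [IH1 IH2]]; split=> //.
by rewrite gstringSSS size_cat IH1 IH2 -fibSS.
Qed.

Lemma fib_gt0 n : 0 < fib n.+1.
Proof.
suff /andP[] : (0 < fib n.+1) && (0 < fib n.+2) by [].
elim: n => // n /andP[h1 h2].
by rewrite h2 fibSS addn_gt0 h2.
Qed.

Lemma leq_fibS n : n <= fib n.+1.
Proof.
elim: n => // -[//|n] IH.
by have := leq_add IH (fib_gt0 n); rewrite addn1.
Qed.

Lemma leq_fib m n : m <= n -> fib m.+1 <= fib n.+1.
Proof.
move/subnK <-; elim: (n - m) => // p IH; rewrite addSn fibSS.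
exact: leq_trans IH (leq_addr _ _).
Qed.

Lemma nth_gstring_le m n i : 1 <= m <= n -> i < size (gstring m) ->
  nth LB (gstring n) i = nth LB (gstring m) i.
Proof.
move=> /andP[m1]; elim: n => [|n IH].
  by rewrite leqn0 => /eqP m0; rewrite m0 in m1.
rewrite leq_eqVlt => /orP[/eqP->//|]; rewrite ltnS => lmn hi.
rewrite -(IH lmn hi).
case: n lmn {IH} => [|[|n]] lmn; first by case: m m1 lmn hi.
  by case: m m1 lmn hi => [|[|m]] //= _ _; case: i.
have hi' : i < size (gstring n.+2).
  by apply: leq_trans hi _; rewrite !size_gstring //; exact: leq_fib.
by rewrite gstringSSS nth_cat hi'.
Qed.

Lemma golden_prefix n i : 1 <= n -> 1 <= i <= size (gstring n) ->
  nth LB (gstring n) i.-1 = golden i.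
Proof.
case: i => // i n1 /= hi; rewrite /golden /=.
case: (leqP n i.+1) => h.
  by rewrite -(@nth_gstring_le n i.+1) ?n1.
rewrite (@nth_gstring_le i.+1 n) ?(ltnW h) //.
by rewrite size_gstring // leq_fibS.
Qed.

Lemma sum_delta N m (w : nat -> nat) l : l <= m < N ->
  \sum_(l <= i < N) (i == m) * w i = w m.
Proof.
move=> /andP[lm mN]; rewrite (big_cat_nat lm (ltnW mN)) /= (big_ltn mN) eqxx mul1n.
rewrite big_nat big1 => [|i /andP[_ im]]; last by rewrite ltn_eqF.
rewrite big_nat big1 => [|i /andP[mi _]]; last by rewrite gtn_eqF.
by rewrite addn0.
Qed.

Lemma B_unbounded k M : 1 <= k -> exists2 n, M < n & B k n.
Proof.
move=> k1; pose m := (k + M).+1.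
have km : k < m by rewrite ltnS leq_addr.
have Mm : M < fib (2 * m).
  have -> : 2 * m = (m + m.-1).+1 by rewrite mul2n -addnn addnS.
  apply: leq_trans (leq_fibS _).
  by rewrite /m /= addSn ltnS -addnA addnCA leq_addr.
exists (fib (2 * k) + fib (2 * m)); first exact: ltn_addl.
split; first by rewrite addn_gt0 (leq_ltn_trans _ Mm) ?orbT.
exists (fun i => (i == k) + (i == m)); split.
- exists m.+1; split.
  + move=> i; rewrite addn_eq0 negb_and !eqb0 !negbK ltnS.
    by case/orP => /eqP ->; rewrite ?k1 ?(ltnW km) ?leqnn.
  + by move=> i; case: (i == k); case: (i == m).
  + move=> i1 i2 _; case: (eqVneq i1 k) => [->|_]; last by case: (i1 == m).
    by rewrite ltn_eqF.
  + rewrite (eq_bigr (fun i => (i == k) * fib (2 * i) + (i == m) * fib (2 * i))).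
      by rewrite big_split /= !sum_delta ?k1 ?ltnS ?leqnn ?(ltnW km).
    by move=> i _; rewrite mulnDl.
- by rewrite eqxx.
- by move=> i ik; rewrite !ltn_eqF // (ltn_trans ik).
Qed.

Lemma increasing_enum_B k : 1 <= k -> exists q, increasing_enum (B k) q.
Proof.
move=> k1.
pose b n : bool := if excluded_middle_informative (B k n) then true else false.
have bP n : reflect (B k n) (b n).
  by rewrite /b; case: excluded_middle_informative => h; constructor.
have nx M : exists n, (M < n) && b n.
  by have [n h /bP h'] := B_unbounded M k1; exists n; rewrite h.
pose q j := iter j (fun M => ex_minn (nx M)) 0.
have qS j : [/\ q j < q j.+1, b (q j.+1) & forall n, q j < n -> b n -> q j.+1 <= n].
  rewrite /q /=; case: ex_minnP => n /andP[h1 h2] hn; split=> // n' h3 h4.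
  by apply: hn; rewrite h3.
have qlt : {homo q : i j / i < j}.
  by apply: homo_ltn => [y x z|i]; [exact: ltn_trans | have [] := qS i].
exists q; split=> [i j _|n]; first exact: qlt.
split=> [Bn|[[|j] [//] _ <-]]; last by apply/bP; have [] := qS j.
have qge j : j <= q j by elim: j => // j IH; apply: leq_ltn_trans IH (qlt _ _ _).
have : exists j, n <= q j by exists n.
case/ex_minnP=> -[|j] nq mj.
  by case: Bn; rewrite lt0n -leqn0 nq.
exists j.+1; split=> //; apply/eqP; rewrite eqn_leq nq andbT.
have [_ _ h] := qS j; apply: h; last exact/bP.
by rewrite ltnNge; apply/negP => /mj; rewrite ltnn.
Qed.

(* Main.v *)
(* For n > k, adding or removing one F_{2n} shows that m in [F_{2n}, F_{2n+2})
   lies in B_{2k} iff m - F_{2n} does.  Hence, for every M > 2k, the elements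
   of B_{2k} in [F_M, F_{M+1}) are F_M + e, where e = F_{2k} if M is even and
   e = F_{2k-2} if M is odd, followed by the F_M + x for x < F_{M-1} in
   B_{2k} other than F_{2k}.  This writes down their Zeckendorf decompositions
   recursively; labelling an element A if F_{2k} occurs in it and B otherwise,
   the label words satisfy the recursion of the strings S_n, each with its last
   letter removed. *)

Require Import Defs.
From mathcomp Require Import all_boot zify.
From Stdlib Require Import Classical.

Set Implicit Arguments.
Unset Strict Implicit.
Unset Printing Implicit Defensive.

(** * Fibonacci identities and monotonicity *)

Lemma fib_dblS n : fib (2 * n.+1) = fib (2 * n).+1 + fib (2 * n).
Proof. by rewrite mulnS. Qed.

Lemma fib_dblSS n : fib (2 * n.+1).+1 = fib (2 * n.+1) + fib (2 * n).+1.
Proof. by rewrite mulnS. Qed.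

Lemma fib_mono m n : m <= n -> fib m <= fib n.
Proof. by case: m => // m; case: n => // n; rewrite ltnS; exact: leq_fib. Qed.

Lemma fib_ltS n : 2 <= n -> fib n < fib n.+1.
Proof.
by case: n => [|[|n]] // _; rewrite (fibSS n.+1) -[ltnLHS]addn0 ltn_add2l fib_gt0.
Qed.

(** * Zeckendorf digits *)

Definition zdigits (a : nat -> nat) : Prop :=
  (forall i, a i <= 1) /\ (forall i, ~ (a i = 1 /\ a i.+1 = 1)).

Definition zsum (a : nat -> nat) (N : nat) : nat :=
  \sum_(2 <= i < N) a i * fib i.

Lemma zsumS a N : 2 <= N -> zsum a N.+1 = zsum a N + a N * fib N.
Proof. by move=> h; rewrite /zsum big_nat_recr. Qed.

(** Two consecutive bounds go through the induction together: a digit 1 at [n.+3] forces a 0 at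
    [n.+2], so the remaining digits sum to less than F_{n+2}. *)
Lemma zsum_lt a N : zdigits a -> 2 <= N -> zsum a N < fib N.
Proof.
move=> [a1 an].
suff H n : zsum a n.+2 < fib n.+2 /\ zsum a n.+3 < fib n.+3.
  by case: N => [|[|n]] // _; have [] := H n.
elim: n => [|n [IH1 IH2]].
  have e2 : zsum a 2 = 0 by rewrite /zsum big_geq.
  by rewrite (@zsumS a 2) // e2; split=> //=; have := a1 2; lia.
split=> //.
rewrite (@zsumS a n.+3) // (fibSS n.+2).
have := a1 n.+3; case E: (a n.+3) => [|[|//]] _; first lia.
rewrite (@zsumS a n.+2) //.
have := a1 n.+2; case E': (a n.+2) => [|[|//]] _; last by case: (an n.+2).
lia.
Qed.

(** The digits below N sum to less than F_N, so the value determines the top digit; then descend. *)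
Lemma zsum_inj a b N : zdigits a -> zdigits b -> zsum a N = zsum b N ->
  forall i, 2 <= i < N -> a i = b i.
Proof.
move=> za zb; elim: N => [|N IH] e i; first by lia.
case: (leqP 2 N) => N2; last by lia.
move: e; rewrite !zsumS // => e.
have ha := zsum_lt za N2; have hb := zsum_lt zb N2.
have := za.1 N; have := zb.1 N => hbN haN.
have eN : a N = b N.
  move: e haN hbN; case: (a N) => [|[|//]]; case: (b N) => [|[|//]]; lia.
have {}IH := IH ltac:(rewrite eN in e; lia).
move=> /andP[i2]; rewrite ltnS leq_eqVlt => /orP[/eqP->//|iN].
by apply: IH; rewrite i2.
Qed.

Lemma zsum_widen a N M : (forall i, a i != 0 -> 2 <= i < N) -> N <= M ->
  zsum a M = zsum a N.
Proof.
move=> sa; elim: M => [|M IH]; first by rewrite leqn0 => /eqP->.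
rewrite leq_eqVlt => /orP[/eqP->//|]; rewrite ltnS => NM.
case: (leqP 2 M) => M2; last first.
  by rewrite /zsum !big_geq //; lia.
rewrite zsumS // IH //.
case: (eqVneq (a M) 0) => [->|/sa]; first by rewrite mul0n addn0.
lia.
Qed.

Lemma zeckendorf_uniq a b n : zeckendorf a n -> zeckendorf b n -> a =1 b.
Proof.
move=> [N [sa a1 an ea]] [M [sb b1 bn eb]] i.
have h : zsum a (N + M) = zsum b (N + M).
  rewrite (zsum_widen sa (leq_addr _ _)) (zsum_widen sb (leq_addl _ _)).
  by rewrite /zsum -ea -eb.
have {}h := zsum_inj (conj a1 an) (conj b1 bn) h.
case: (boolP (2 <= i < N + M)) => [/h//|out].
have [-> ->] // : a i = 0 /\ b i = 0.
by split; apply/eqP; apply: contraNT out => h'; first [have := sa _ h' | have := sb _ h']; lia.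
Qed.

(** * Chung-Graham digits *)

Definition cdigits (c : nat -> nat) : Prop :=
  (forall i, c i <= 2) /\
  (forall i1 i2, i1 < i2 -> c i1 = 2 -> c i2 = 2 ->
     exists j, i1 < j < i2 /\ c j = 0).

Definition csum (c : nat -> nat) (N : nat) : nat :=
  \sum_(1 <= i < N) c i * fib (2 * i).

(* A further digit 2 may be placed at position n exactly when [copen c n]. *)
Definition copen (c : nat -> nat) (n : nat) : Prop :=
  forall i, i < n -> c i = 2 -> exists j, i < j < n /\ c j = 0.

Lemma csumS c N : 1 <= N -> csum c N.+1 = csum c N + c N * fib (2 * N).
Proof. by move=> h; rewrite /csum big_nat_recr. Qed.

(** A digit 2 at n+1 needs the sharper second bound below it, because 2 F_{2n+2} + F_{2n+1} =
    F_{2n+4}; a 2 is legal only when the position is open, so both bounds are carried along. *)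
Lemma csum_ltS c n : cdigits c ->
  csum c n.+1 < fib (2 * n.+1) /\ (copen c n.+1 -> csum c n.+1 < fib (2 * n).+1).
Proof.
move=> [c2 cc]; elim: n => [|n [IH1 IH2]].
  by rewrite /csum big_geq.
rewrite csumS // (fib_dblS n.+1) (fib_dblSS n).
have := fib_dblS n.
have down : c n.+1 != 0 -> copen c n.+2 -> copen c n.+1.
  move=> nz op i hi ci; have [j [hj cj]] := op i (leqW hi) ci.
  exists j; split=> //.
  have : j != n.+1 by apply/eqP => e; rewrite -e cj in nz.
  lia.
have := c2 n.+1; case E: (c n.+1) => [|[|[|//]]] _ f.
- split=> [|_]; lia.
- by split=> [|/(down ltac:(by rewrite E))/IH2]; lia.
- have op : copen c n.+1 by move=> i hi ci; apply: cc.
  have := IH2 op; split; first lia.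
  move=> /(_ n.+1 (ltnSn _) E) [j []]; lia.
Qed.

Lemma csum_lt c n : cdigits c -> 1 <= n -> csum c n < fib (2 * n).
Proof. by case: n => // n hc _; case: (csum_ltS n hc). Qed.

(** The chain starts from 2 F_{2i} >= F_{2i+1}, and each further nonzero digit lifts the bound from
    F_{2n+1} to F_{2n+3}. *)
Lemma csum_not_copen c i n : 1 <= i <= n -> c i = 2 ->
  (forall j, i < j <= n -> c j != 0) -> fib (2 * n).+1 <= csum c n.+1.
Proof.
move=> /andP[i1]; elim: n => [|n IH]; first lia.
rewrite leq_eqVlt => /orP[/eqP<- ci _|].
  rewrite csumS // ci.
  have : fib (2 * i).+1 <= 2 * fib (2 * i).
    case: (i) i1 => // n0 _; rewrite fib_dblSS; have := fib_dblS n0; lia.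
  lia.
rewrite ltnS => le_in ci nz.
have := IH le_in ci (fun j hj => nz j ltac:(lia)).
have := nz n.+1 ltac:(lia).
rewrite (@csumS c n.+1) // fib_dblSS; case: (c n.+1) => // m _; nia.
Qed.

(** Contrapositive of [csum_not_copen]: openness can be read off the size of the sum, which
    justifies raising a digit to 2. *)
Lemma copen_csum c n : (forall i, c i != 0 -> 1 <= i) ->
  csum c n.+1 < fib (2 * n).+1 -> copen c n.+1.
Proof.
move=> sc lt i hi ci; apply: NNPP => no.
have i1 : 1 <= i by apply: sc; rewrite ci.
suff : fib (2 * n).+1 <= csum c n.+1 by lia.
apply: (@csum_not_copen c i n) => // [|j hj]; first lia.
by apply/eqP => cj; apply: no; exists j; split.
Qed.

(** * Membership in B_{2k} with bounded digit positions *)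

Definition Bbelow (k n m : nat) : Prop :=
  exists c, [/\ cdigits c, forall i, c i != 0 -> k <= i < n, c k != 0 & m = csum c n].

Lemma csum_widen c N M : (forall i, c i != 0 -> 1 <= i < N) -> N <= M ->
  csum c M = csum c N.
Proof.
move=> sa; elim: M => [|M IH]; first by rewrite leqn0 => /eqP->.
rewrite leq_eqVlt => /orP[/eqP->//|]; rewrite ltnS => NM.
case: (leqP 1 M) => M2; last first.
  by rewrite /csum !big_geq //; lia.
rewrite csumS // IH //.
case: (eqVneq (c M) 0) => [->|/sa]; first by rewrite mul0n addn0.
lia.
Qed.

Lemma csum_ge c N i : 1 <= i < N -> c i * fib (2 * i) <= csum c N.
Proof.
elim: N => [|N IH] hi; first lia.
rewrite csumS; last lia.
case: (eqVneq i N) => [->|ne]; first lia.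
have := IH ltac:(lia); lia.
Qed.

Lemma Bbelow_B k n m : 1 <= k -> Bbelow k n m -> B k m.
Proof.
move=> k1 [c [cd sc ck e]]; split.
  rewrite e; have hk := sc _ ck.
  apply: leq_trans (@csum_ge c n k ltac:(lia)).
  rewrite muln_gt0 lt0n ck /=; case: (k) k1 => // p _.
  by rewrite mulnS fib_gt0.
exists c; split=> //.
- by exists n; split=> //; [move=> i /sc; lia | exact: cd.1 | exact: cd.2].
- by move=> i ik; apply/eqP; apply: contraTT ik => /sc; lia.
Qed.

(** A nonzero digit at a position i >= n would contribute at least F_{2n} > m. *)
Lemma B_Bbelow k n m : B k m -> m < fib (2 * n) -> Bbelow k n m.
Proof.
move=> [m0 [c [[N [sc c2 cc e]] ck cl]]] mn.
have supp i : c i != 0 -> 1 <= i < n.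
  move=> ci; have hi := sc _ ci.
  have := csum_ge c hi; rewrite /csum -e => le.
  case: (leqP n i) => ni; last lia.
  have := @fib_mono (2 * n) (2 * i) ltac:(lia).
  nia.
exists c; split=> //.
- move=> i ci; have := supp i ci; case: (leqP k i) => ki; first lia.
  by rewrite cl in ci.
- rewrite e -[LHS]/(csum c N) -(csum_widen sc (leq_addr n N)).
  by rewrite -(csum_widen supp (leq_addl N n)).
Qed.

Lemma B_small k m : 1 <= k -> m < fib (2 * k.+1) ->
  B k m <-> m = fib (2 * k) \/ m = 2 * fib (2 * k).
Proof.
move=> k1 mk; split.
  move=> /B_Bbelow/(_ mk) [c [[c2 _] sc ck ->]].
  have -> : csum c k.+1 = c k * fib (2 * k).
    rewrite csumS // /csum big_nat big1 // => i hi.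
    case: (eqVneq (c i) 0) => [->//|/sc]; lia.
  have := c2 k; case: (c k) ck => [|[|[|//]]] // _ _; [left|right]; lia.
have key d : 0 < d <= 2 -> B k (d * fib (2 * k)).
  move=> hd; apply: (@Bbelow_B _ k.+1) => //.
  exists (fun i => (i == k) * d); split.
  - split=> [i|i j ij]; first by case: (i == k); lia.
    case: (eqVneq i k) => [ik|//]; case: (eqVneq j k) => [jk|//]; lia.
  - by move=> i; case: (eqVneq i k) => // ->; lia.
  - by rewrite eqxx; lia.
  - rewrite /csum -(@sum_delta k.+1 k (fun i => d * fib (2 * i)) 1); last lia.
    by apply: eq_bigr => i _; rewrite mulnA.
by case=> ->; [rewrite -[fib _]mul1n|]; apply: key.
Qed.

(** * Changing the leading Chung-Graham digit *)

Lemma eq_csum c d n : (forall i, i < n -> c i = d i) -> csum c n = csum d n.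
Proof.
by move=> e; rewrite /csum !big_nat; apply: eq_bigr => i /andP[_ h]; rewrite e.
Qed.

(* Lower the leading digit by 1. *)
Lemma B_sub k n m : 1 <= k < n -> fib (2 * n) <= m < fib (2 * n.+1) ->
  B k m -> B k (m - fib (2 * n)).
Proof.
move=> hk /andP[le lt] Bm; have [c [cd sc ck e]] := B_Bbelow Bm lt.
have n1 : 1 <= n by lia.
have h := csum_lt cd n1.
(* Without a digit at n, m would be below F_{2n} by [csum_lt]. *)
have cn : c n != 0.
  by apply/eqP => c0; move: e; rewrite csumS // c0; lia.
apply: (@Bbelow_B _ n.+1); first lia.
pose d i := c i - (i == n).
have dE i : i != n -> d i = c i by rewrite /d => /negbTE->; rewrite subn0.
have dlt i : i < n -> d i = c i by move=> ?; apply: dE; rewrite neq_ltn; apply/orP; left.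
have cn2 := cd.1 n.
have dn : d n = c n - 1 by rewrite /d eqxx.
exists d; split.
- split=> [i|i1 i2 i12]; first by have := cd.1 i; rewrite /d; lia.
  case: (eqVneq i1 n) => [->|n1']; first by rewrite dn; lia.
  case: (eqVneq i2 n) => [->|n2]; first by rewrite dn; lia.
  rewrite !dE // => e1 e2; have [j [hj cj]] := cd.2 _ _ i12 e1 e2.
  by exists j; split=> //; rewrite /d cj.
- by move=> i di; apply: sc; apply: contraNneq di => ci; rewrite /d ci.
- by rewrite dlt //; lia.
- rewrite e !csumS // dn (eq_csum dlt).
  by case: (c n) cn => // p _; rewrite subn1 mulSn /= addnCA addKn.
Qed.

(* Raise the leading digit by 1; a bound on m keeps the digits valid. *)
Lemma B_add k n m : 1 <= k < n -> m < fib (2 * n).+1 ->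
  B k m -> B k (fib (2 * n) + m).
Proof.
move=> hk lt Bm.
have n1 : 1 <= n by lia.
have fS := fib_dblS n.
have lt' : m < fib (2 * n.+1) by lia.
have [c [cd sc ck e]] := B_Bbelow Bm lt'.
have f2 : fib (2 * n).+1 <= 2 * fib (2 * n).
  by case: (n) n1 => // p _; rewrite fib_dblSS; have := fib_dblS p; lia.
have es : m = csum c n + c n * fib (2 * n) by rewrite e csumS.
have cn : c n <= 1.
  rewrite leqNgt; apply/negP => h; nia.
(* If the digit is 1, the lower digits sum to less than F_{2n+1} - F_{2n} = F_{2n-1}, so a 2 is
   allowed at n. *)
have op : c n = 1 -> copen c n.
  move=> cn1; case: (n) n1 cn1 es lt => // p _ cp es'; rewrite fib_dblSS => lt1.
  apply: copen_csum; last by rewrite cp in es'; lia.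
  by move=> i /sc; lia.
apply: (@Bbelow_B _ n.+1); first lia.
pose d i := c i + (i == n).
have dE i : i != n -> d i = c i by rewrite /d => /negbTE->; rewrite addn0.
have dlt i : i < n -> d i = c i by move=> ?; apply: dE; rewrite neq_ltn; apply/orP; left.
have dn : d n = (c n).+1 by rewrite /d eqxx addn1.
exists d; split.
- split=> [i|i1 i2 i12].
    by case: (eqVneq i n) => [->|/dE->]; [rewrite dn; lia | exact: cd.1].
  case: (eqVneq i2 n) => [i2n|n2].
    rewrite i2n dn => e1 e2; rewrite i2n in i12.
    rewrite dlt // in e1.
    have [j [hj cj]] := op ltac:(lia) i1 i12 e1.
    by exists j; split=> //; rewrite dlt //; lia.
  case: (eqVneq i1 n) => [i1n|n1'].
    rewrite (dE i2) // => _ e2; have := sc i2 ltac:(by rewrite e2); lia.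
  rewrite !dE // => e1 e2; have [j [hj cj]] := cd.2 _ _ i12 e1 e2.
  exists j; split=> //; rewrite dE //; apply/eqP => jn.
  have := sc i2 ltac:(by rewrite e2); lia.
- move=> i; case: (eqVneq i n) => [->|/dE->]; [lia | exact: sc].
- by rewrite dlt //; lia.
- by rewrite es csumS // dn (eq_csum dlt); lia.
Qed.

Lemma B_rec k n m : 1 <= k < n -> fib (2 * n) <= m < fib (2 * n.+1) ->
  B k m <-> B k (m - fib (2 * n)).
Proof.
move=> hk hm; split=> [|Bm]; first exact: B_sub.
rewrite -(subnKC (m := fib (2 * n)) (n := m)); last by case/andP: hm.
by apply: B_add => //; have := fib_dblS n; lia.
Qed.

(** * The elements of B_{2k} *)

Section Elements.

Local Arguments fib : simpl never.

Variable k : nat.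
Hypothesis k1 : 1 <= k.

(** The least element F_{2k} is split off: the theorem speaks of the later ones, and above an
    odd-indexed Fibonacci number its translate is replaced by that of F_{2k-2}. *)
Definition Brest (m : nat) : Prop := B k m /\ m <> fib (2 * k).

Definition offset (i : nat) : nat := if odd i then fib (2 * k - 2) else fib (2 * k).

(** This plays two parts: the label of F_{2k+i} + [offset i], and for i >= 1 the last letter of
    S_i. *)
Definition last_letter (i : nat) : letter := if odd i then LB else LA.

(** The identity puts 2 F_{2k} into the form F_{2k+1} + F_{2k-2}, the first odd-indexed case. *)
Lemma fib_2k : fib (2 * k).+1 + fib (2 * k - 2) = 2 * fib (2 * k) /\
  fib (2 * k - 2) < fib (2 * k) < fib (2 * k).+1.
Proof.
case: k k1 => // p _; have -> : 2 * p.+1 - 2 = 2 * p by lia.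
rewrite fib_dblSS; have := fib_dblS p; have := @fib_gt0 (2 * p); lia.
Qed.

Lemma Brest_ge m : Brest m -> fib (2 * k).+1 <= m.
Proof.
move=> [Bm ne]; rewrite leqNgt; apply/negP => lt.
have := fib_dblS k; have [e1 e2] := fib_2k => e3.
have [|] := (B_small k1 (m := m) ltac:(lia)).1 Bm; lia.
Qed.

Lemma Brest_rec_even n m : k < n -> fib (2 * n) <= m < fib (2 * n).+1 ->
  Brest m <-> m = fib (2 * n) + fib (2 * k) \/ Brest (m - fib (2 * n)).
Proof.
move=> kn hm.
have h1 : 1 <= k < n by lia.
have h2 : fib (2 * n) <= m < fib (2 * n.+1) by have := fib_dblS n; lia.
have R := B_rec h1 h2.
have [_ /andP[_ f1]] := fib_2k.
have f2 := @fib_mono (2 * k).+1 (2 * n) ltac:(lia).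
rewrite /Brest R; split=> [[Bm ne]|[e|[Bm _]]]; last by split=> //; lia.
- case: (eqVneq (m - fib (2 * n)) (fib (2 * k))) => [e|/eqP]; [left; lia | by right].
- rewrite e addKn; split; last lia.
  by apply/(B_small k1); [have := fib_dblS k; lia | left].
Qed.

(** [B_rec] removes only even-indexed Fibonacci numbers, so removal of F_{2n+1} is obtained by
    induction on n, subtracting F_{2n} first. *)
Lemma Brest_rec_odd n m : k <= n -> fib (2 * n).+1 <= m < fib (2 * n.+1) ->
  Brest m <-> m = fib (2 * n).+1 + fib (2 * k - 2) \/ Brest (m - fib (2 * n).+1).
Proof.
have [E0 /andP[E1 E2]] := fib_2k; have E3 := fib_dblS k.
elim: n m => [|n IH] m; first lia.
(* Base case: the only element in the range is 2 F_{2k}. *)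
rewrite leq_eqVlt => /orP[/eqP <- hm|].
  rewrite E0 {1}/Brest (B_small k1); last lia.
  split=> [[[//|->] _]|[->|/Brest_ge]]; first by left.
    by split; [right | lia].
  lia.
rewrite ltnS => kn hm.
have F1 := fib_dblS n; have F2 := fib_dblSS n; have F3 := fib_dblS n.+1.
have M1 := @fib_mono (2 * k) (2 * n) ltac:(lia).
have M2 := @fib_mono (2 * k).+1 (2 * n).+1 ltac:(lia).
have hkn : 1 <= k < n.+1 by lia.
have CB : Brest m <-> B k (m - fib (2 * n.+1)).
  rewrite /Brest (B_rec hkn); last lia.
  by split=> [[]|] //; split=> //; lia.
rewrite {}CB; set m' := m - fib (2 * n.+1).
have hm' : m = fib (2 * n.+1) + m' by rewrite subnKC //; lia.
(* If m' < F_{2n+2}, the induction hypothesis removes F_{2n+1} from m', and F_{2n+2} + F_{2n+1} =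
   F_{2n+3}. *)
case: (ltnP m' (fib (2 * n.+1))) => lt.
  have -> : B k m' <-> Brest m' by rewrite /Brest; split=> [|[]//]; split=> //; lia.
  rewrite IH //; last lia.
  have -> : m' - fib (2 * n).+1 = m - fib (2 * n.+1).+1 by lia.
  split=> -[h|h]; by [right | left; lia].
(* Otherwise F_{2n+2} comes off a second time, leaving x. Since 2 F_{2n+2} = F_{2n+3} + F_{2n}, it
   remains to compare x with F_{2n} + x. *)
rewrite (B_rec hkn); last lia.
set x := m' - _; have hx : m - fib (2 * n.+1).+1 = fib (2 * n) + x by lia.
rewrite hx.
have -> : (m = fib (2 * n.+1).+1 + fib (2 * k - 2) \/ Brest (fib (2 * n) + x)) <->
    Brest (fib (2 * n) + x).
  by split=> [[|//]|]; [lia | right].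
(* For n = k both sides are settled by [B_small]; for n > k one more use of [B_rec] suffices. *)
move: kn; rewrite leq_eqVlt => /orP[/eqP kn|kn].
  have hx' : m' = fib (2 * n.+1) + x by rewrite subnKC.
  clearbody x m'; subst n.
  rewrite /Brest (B_small k1); last lia.
  rewrite (B_small k1); last lia.
  lia.
have M3 := @fib_mono (2 * k).+1 (2 * n) ltac:(lia).
rewrite /Brest (@B_rec k n (fib (2 * n) + x)); [|lia|lia].
rewrite addKn; split=> [|[]//]; split=> //; lia.
Qed.

Lemma Brest_rec i m : 1 <= i -> fib (2 * k + i) <= m < fib (2 * k + i).+1 ->
  Brest m <-> m = fib (2 * k + i) + offset i \/ Brest (m - fib (2 * k + i)).
Proof.
rewrite -[i]odd_double_half /offset oddD odd_double addbF oddb.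
case: (odd i) => /=; rewrite ?add1n ?add0n => i1.
  have -> : 2 * k + (i./2.*2).+1 = (2 * (k + i./2)).+1 by lia.
  by move=> h; apply: Brest_rec_odd; [lia | rewrite mulnS].
have -> : 2 * k + i./2.*2 = 2 * (k + i./2) by lia.
by apply: Brest_rec_even; lia.
Qed.

Lemma offset_lt i : offset i < fib (2 * k).+1.
Proof. by have [_] := fib_2k; rewrite /offset; case: (odd i); lia. Qed.

Lemma offset_bound i : fib (2 * k + i.+1) + offset i.+1 < fib (2 * k + i.+2).
Proof.
rewrite !addnS fibSS ltn_add2l; have [_ /andP[f1 f2]] := fib_2k.
rewrite /offset /=; case: i => [|i]; first by rewrite addn0.
have := @fib_mono (2 * k).+1 (2 * k + i.+1) ltac:(lia).
by case: ifP; lia.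
Qed.

(* The elements of [Brest] below F_(2k+i+1), in increasing order, each paired with
   the letter it carries. *)
Fixpoint block (i : nat) : seq (nat * letter) :=
  let top j := (fib (2 * k + j) + offset j, last_letter j) in
  match i with
  | 0 => [::]
  | j.+1 => match j with
            | 0 => [:: top 1]
            | p.+1 => block j ++
                top j.+1 :: [seq (fib (2 * k + j.+1) + x.1, x.2) | x <- block p]
            end
  end.

Lemma blockSS i : block i.+2 = block i.+1 ++
  (fib (2 * k + i.+2) + offset i.+2, last_letter i.+2) ::
  [seq (fib (2 * k + i.+2) + x.1, x.2) | x <- block i].
Proof. by []. Qed.

(* The golden words obey the same recursion as the blocks, up to their last
   letter, which alternates. *)
Lemma gstring_block i :
  gstring i.+1 = rcons (unzip2 (block i)) (last_letter i.+1).
Proof.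
suff [] : gstring i.+1 = rcons (unzip2 (block i)) (last_letter i.+1) /\
  gstring i.+2 = rcons (unzip2 (block i.+1)) (last_letter i.+2) by [].
elim: i => [//|i [IH1 IH2]]; split=> //.
rewrite gstringSSS IH1 IH2 blockSS /unzip2 map_cat /= -map_comp rcons_cat.
by rewrite cat_rcons rcons_cons /last_letter /= negbK.
Qed.

Lemma unzip1_blockSS i : unzip1 (block i.+2) = unzip1 (block i.+1) ++
  (fib (2 * k + i.+2) + offset i.+2) ::
  [seq fib (2 * k + i.+2) + x | x <- unzip1 (block i)].
Proof. by rewrite blockSS /unzip1 map_cat /= -!map_comp. Qed.

Lemma mem_block i x :
  (x \in unzip1 (block i)) <-> Brest x /\ x < fib (2 * k + i).+1.
Proof.
(* [Brest_rec] by ranges: the elements below F_{2k+j+2} are those below F_{2k+j+1}, one new element,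
   and translates of those below F_{2k+j}. *)
have rec j y : Brest y /\ y < fib (2 * k + j.+1).+1 <->
  (Brest y /\ y < fib (2 * k + j).+1) \/ y = fib (2 * k + j.+1) + offset j.+1 \/
  [/\ Brest (y - fib (2 * k + j.+1)), y - fib (2 * k + j.+1) < fib (2 * k + j)
    & fib (2 * k + j.+1) <= y].
  have fS : fib (2 * k + j.+1).+1 = fib (2 * k + j.+1) + fib (2 * k + j).
    by rewrite addnS.
  have f2 := offset_bound j; rewrite [2 * k + j.+2]addnS in f2.
  rewrite -(addnS (2 * k) j).
  case: (leqP (fib (2 * k + j.+1)) y) => le.
    have R h := @Brest_rec j.+1 y isT h.
    split=> [[Cy lt]|].
      have [|->|Cy'] := (R _).1 Cy; first by rewrite le.
        by right; left.
      by right; right; split=> //; lia.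
    case=> [[]|[e|[Cy lt _]]]; first lia.
      by split; [apply/R; [lia | left] | lia].
    by split; [apply/R; [lia | right] | lia].
  split=> [[Cy _]|[[Cy _]|[|[_ _]]]]; [by left| |lia|lia].
  by split=> //; lia.
have [_ /andP[f1 f2]] := fib_2k.
have no y : ~ (Brest y /\ y < fib (2 * k + 0).+1).
  by rewrite addn0 => -[/Brest_ge]; lia.
suff [] : ((x \in unzip1 (block i)) <-> Brest x /\ x < fib (2 * k + i).+1) /\
  ((x \in unzip1 (block i.+1)) <-> Brest x /\ x < fib (2 * k + i.+1).+1) by [].
elim: i x => [|i IH] x; split; last 1 first.
- rewrite unzip1_blockSS mem_cat inE rec -(IH x).2.
  have -> : [/\ Brest (x - fib (2 * k + i.+2)), x - fib (2 * k + i.+2) < fib (2 * k + i.+1)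
      & fib (2 * k + i.+2) <= x] <->
      x \in [seq fib (2 * k + i.+2) + y | y <- unzip1 (block i)].
    split=> [[Cx lt le]|/mapP[y /(IH _).1 [Cy lt] ->]].
      apply/mapP; exists (x - fib (2 * k + i.+2)); last by rewrite subnKC.
      by apply/(IH _).1; split=> //; rewrite -addnS.
    by rewrite addKn leq_addr; split=> //; rewrite addnS.
  split=> [/orP[|/orP[/eqP|]]|[->|[->|->]]]; rewrite ?eqxx ?orbT //.
  + by left.
  + by right; left.
  + by right; right.
- by split=> // /no.
- rewrite rec inE; split=> [/eqP->|[/no//|[->//|[/Brest_ge]]]]; first by right; left.
  by rewrite addn0; lia.
- exact: (IH x).2.
Qed.

(** The old block lies below the Fibonacci number added, and the offset is below F_{2k+1}, hence
    below every translated element. Putting F_{2k} in front gives an initial segment of B_{2k}. *)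
Lemma block_sorted i : sorted ltn (fib (2 * k) :: unzip1 (block i)).
Proof.
have [_ /andP[f1 f2]] := fib_2k.
rewrite (sorted_pairwise ltn_trans) /=; apply/andP; split.
  by apply/allP => x /mem_block [/Brest_ge]; rewrite /=; lia.
suff [] : pairwise ltn (unzip1 (block i)) /\ pairwise ltn (unzip1 (block i.+1)) by [].
elim: i => [//|i [IH1 IH2]]; split=> //.
rewrite unzip1_blockSS pairwise_cat IH2 /= pairwise_map.
apply/and3P; split.
- apply/allrelP => x y hx; rewrite inE => hy; have [_ lt] := (mem_block i.+1 x).1 hx.
  rewrite -addnS in lt; apply: leq_trans lt _.
  by case/orP: hy => [/eqP->|/mapP[z _ ->]]; exact: leq_addr.
- apply/allP => y /mapP[z /mem_block [/Brest_ge hz _] ->] /=.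
  by rewrite ltn_add2l; apply: leq_trans hz; exact: offset_lt.
- by apply: sub_pairwise IH1 => x y /=; rewrite ltn_add2l.
Qed.

(** * Zeckendorf representations of the labelled elements *)

(* The digits start at index 2k-2, and the letter records whether F_(2k) is
   one of the summands. *)
Definition zrep (N m : nat) (l : letter) : Prop :=
  exists a, [/\ zdigits a, forall i, a i != 0 -> 2 <= i < N /\ 2 * k - 2 <= i,
    m = zsum a N & a (2 * k) = 1 <-> l = LA].

Lemma zrep_widen N M m l : N <= M -> zrep N m l -> zrep M m l.
Proof.
move=> NM [a [za sa -> la]]; exists a; split=> //.
- by move=> i /sa; lia.
- by rewrite (@zsum_widen a N) // => i /sa [].
Qed.

(** The old digits sit below N < M, so index M-1 is free; 2k < M leaves the digit at 2k, and so the
    letter, unchanged. *)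
Lemma zrep_add N M m l : N < M -> 2 * k < M -> zrep N m l ->
  zrep M.+1 (fib M + m) l.
Proof.
move=> NM kM [a [[a1 an] sa -> la]].
have M2 : 2 <= M by lia.
pose b i := a i + (i == M).
have aM : a M = 0 by apply/eqP; apply: contraT => /sa; lia.
have aM' j : j.+1 = M -> a j = 0 by move=> e; apply/eqP; apply: contraT => /sa; lia.
have aM1 : a M.+1 = 0 by apply/eqP; apply: contraT => /sa; lia.
exists b; split.
- split=> i; rewrite /b.
    by case: eqP => [->|_]; rewrite ?aM // addn0.
  case: (eqVneq i M) => [->|_]; first by rewrite aM1 gtn_eqF //=; lia.
  case: (eqVneq i.+1 M) => [/aM'->|_]; first lia.
  by rewrite !addn0; apply: an.
- move=> i; rewrite /b; case: (eqVneq i M) => [->|_]; first lia.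
  by rewrite addn0 => /sa; lia.
- rewrite zsumS // {2}/b aM eqxx mul1n addnC; congr (_ + _).
  rewrite -(@zsum_widen a N M) ?(ltnW NM) //; last by move=> i /sa [].
  rewrite /zsum !big_nat; apply: eq_bigr => i /andP[_ iM].
  by rewrite /b ltn_eqF // addn0.
- by rewrite /b ltn_eqF // addn0.
Qed.

Lemma zrep_single i : 2 <= i -> 2 * k - 2 <= i ->
  zrep i.+1 (fib i) (if i == 2 * k then LA else LB).
Proof.
move=> i2 ik; exists (fun j => (j == i) : nat); split.
- split=> j; first by case: (j == i).
  by case: (eqVneq j i) => [->|_] []; rewrite // gtn_eqF.
- by move=> j; case: (eqVneq j i) => [->|//]; lia.
- by rewrite /zsum sum_delta //; lia.
- by rewrite eq_sym; case: (i == 2 * k).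
Qed.

Lemma zrep_2k : zrep (2 * k).+1 (fib (2 * k)) LA.
Proof. by have := @zrep_single (2 * k); rewrite eqxx; apply; lia. Qed.

Lemma zrep_top i : 1 <= i ->
  zrep (2 * k + i).+1 (fib (2 * k + i) + offset i) (last_letter i).
Proof.
move=> i1; rewrite /offset /last_letter; case: ifPn => [_|ev].
  apply: (@zrep_add (2 * k - 1)); [lia|lia|].
  (* For k = 1 the offset is F_0 = 0 and has no digits; for larger k it is a legal digit at 2k-2 >=
     2. *)
  case: (leqP k 1) => [k_1|k_2].
    have -> : k = 1 by lia.
    exists (fun=> 0); split=> //; first by split=> // i0 [].
    by rewrite /zsum big_geq.
  have := @zrep_single (2 * k - 2) ltac:(lia) ltac:(lia).
  rewrite ltn_eqF; last lia.
  by have -> : (2 * k - 2).+1 = 2 * k - 1 by lia.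
apply: (@zrep_add (2 * k).+1) zrep_2k; last lia.
by case: i i1 ev => [|[|i]] //; lia.
Qed.

Lemma block_zrep i x : List.In x (block i) -> zrep (2 * k + i).+1 x.1 x.2.
Proof.
suff [H _] : (forall x, List.In x (block i) -> zrep (2 * k + i).+1 x.1 x.2) /\
  (forall x, List.In x (block i.+1) -> zrep (2 * k + i.+1).+1 x.1 x.2).
  by apply: H.
elim: i => [|i [IH1 IH2]]; split=> //.
  by move=> _ [<-|//]; apply: zrep_top.
move=> y /(List.in_app_or (block i.+1)) [/IH2|].
  by apply: zrep_widen; lia.
case=> [<-|]; first exact: zrep_top.
(* The translates come from two levels down, with digits up to index 2k+i at most, which leaves the
   gap before 2k+i+2 that [zrep_add] needs. *)
move=> /(List.in_map_iff _ (block i) y).1 [z [<- /IH1]] /=.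
by apply: zrep_add; lia.
Qed.

Lemma zrep_zeckendorf N m l : zrep N m l -> exists a,
  [/\ zeckendorf a m, forall i, a i != 0 -> 2 * k - 2 <= i & a (2 * k) = 1 <-> l = LA].
Proof.
move=> [a [[a1 an] sa -> la]]; exists a; split=> //; last by move=> i /sa [].
by exists N; split=> // i /sa [].
Qed.

Lemma fib_inj i j : 2 <= i -> 2 <= j -> fib i = fib j -> i = j.
Proof.
have mono a b : 2 <= a -> a < b -> fib a < fib b.
  by move=> a2 ab; apply: leq_trans (fib_ltS a2) (fib_mono ab).
move=> i2 j2 e; case: (ltngtP i j) => // h.
- by have := mono _ _ i2 h; rewrite e ltnn.
- by have := mono _ _ j2 h; rewrite e ltnn.
Qed.

(** [Z] speaks of values and of any decomposition: [fib_inj] recovers the index, and uniqueness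
    transfers the digit. *)
Lemma zrep_Z N m l : zrep N m l -> (Z m (fib (2 * k)) <-> l = LA).
Proof.
move/zrep_zeckendorf => [a [za _ <-]]; split=> [[b [zb [i [bi e]]]]|a1].
  have ab := zeckendorf_uniq za zb.
  case: (zb) => M [sb _ _ _]; have := sb i; rewrite bi => /(_ isT) hi.
  by rewrite ab (@fib_inj (2 * k) i) //; lia.
by exists a; split=> //; exists (2 * k).
Qed.

Lemma zrep_min N m l : 0 < m -> zrep N m l ->
  exists f, is_min (Z m) f /\ fib (2 * k - 2) <= f.
Proof.
move=> m0 /zrep_zeckendorf [a [za ka _]].
have [i ai mi] : exists2 i, a i != 0 & forall j, a j != 0 -> i <= j.
  have ex : exists i, a i != 0.
    apply: NNPP => no; case: za => M [_ _ _ e].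
    move: m0; rewrite e big1 // => i _; case: (eqVneq (a i) 0) => [->//|h].
    by case: no; exists i.
  by exists (ex_minn ex); case: ex_minnP.
exists (fib i); split; last by apply: fib_mono; apply: ka.
split=> [|f [b [zb [j [bj ->]]]]].
  exists a; split=> //; exists i; split=> //.
  by case: za => M [_ a1 _ _]; have := a1 i; lia.
by apply: fib_mono; apply: mi; rewrite (zeckendorf_uniq za zb) bj.
Qed.

End Elements.

(** * Initial segments of the enumeration, and the conclusion *)

Lemma In_nth (T : Type) (x0 : T) (s : seq T) i : i < size s -> List.In (nth x0 s i) s.
Proof. by elim: s i => // x s IH [|i] h; [left | right; apply: IH]. Qed.

(** A sorted list of all elements below N is an initial segment of the enumeration; positions count
    from 0, while [q] starts at 1. *)
Lemma increasing_enum_nth P q s N : increasing_enum P q -> sorted ltn s ->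
  (forall x, x \in s <-> P x /\ x < N) ->
  forall i, i < size s -> nth 0 s i = q i.+1.
Proof.
move=> [mono enum] ss ms; elim/ltn_ind => i IH lt.
have us := sorted_uniq ltn_trans ltnn ss.
have [Px xN] := (ms _).1 (mem_nth 0 lt).
have [[|j] [// _ e]] := (enum _).1 Px.
(* For j < i an entry of [s] would repeat. For j > i, [q i.+1] is a smaller entry, already met at
   some position l < i as [q l.+1]. *)
case: (ltngtP j i) => [ji|ij|ji]; last by rewrite -e ji.
  rewrite -IH // in e; last exact: ltn_trans ji lt.
  move/eqP: e; rewrite nth_uniq //; [lia | exact: ltn_trans ji lt].
have qlt : q i.+1 < nth 0 s i by rewrite -e; apply: mono.
have : q i.+1 \in s.
  by apply/ms; split; [apply/enum; exists i.+1 | exact: ltn_trans qlt xN].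
case/(nthP 0) => l ls e'.
have li : l < i.
  rewrite ltnNge; apply/negP => il.
  have := sorted_leq_nth leq_trans leqnn 0 (sub_sorted ltnW ss).
  by move=> /(_ i l lt ls il); rewrite e' /=; lia.
by have := mono l.+1 i.+1 isT li; rewrite -(IH l li ls) e' ltnn.
Qed.

Theorem theorem1p3 (k : nat) (hk : 1 <= k)
    (q : nat -> nat) (hq : increasing_enum (B k) q) :
  (forall j : nat, 2 <= j ->
     (Z (q j) (fib (2 * k)) <-> golden (j - 1) = LA)) /\
  (forall j : nat, 1 <= j ->
     exists m : nat, is_min (Z (q j)) m /\ fib (2 * k - 2) <= m).
Proof.
have B2k : B k (fib (2 * k)).
  by apply/(B_small hk); [have := fib_dblS k; have := @fib_2k k hk; lia | left].
have mem i x : x \in fib (2 * k) :: unzip1 (block k i) <->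
    B k x /\ x < fib (2 * k + i).+1.
  rewrite inE; split=> [/orP[/eqP->|/(mem_block hk)[[]]]|[Bx lt]] //.
    split=> //; have := @fib_mono (2 * k).+1 (2 * k + i).+1 ltac:(lia).
    by have := @fib_2k k hk; lia.
  case: (eqVneq x (fib (2 * k))) => //= ne.
  by apply/(mem_block hk); split=> //; split=> //; apply/eqP.
have nthq i j : j <= size (block k i) ->
    nth 0 (fib (2 * k) :: unzip1 (block k i)) j = q j.+1.
  move=> h; apply: (increasing_enum_nth hq (block_sorted hk i) (mem i)).
  by rewrite /= size_map.
have q1 : q 1 = fib (2 * k) by rewrite -(nthq 0 0).
(* Entry t of [block k t.+1] is [q t.+2], as [q 1] is F_{2k}; its label is letter t+1 of the golden
   string. The block has F_{t+3} - 1 > t entries, so the last letter of S_{t+2} is not reached. *)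
have qSS t : exists N, zrep k N (q t.+2) (golden t.+1).
  have sz : (size (block k t.+1)).+1 = fib t.+3.
    by rewrite -size_gstring // (gstring_block k) size_rcons size_map.
  have lt : t < size (block k t.+1).
    by have := @fib_gt0 t; have := leq_fibS t.+1; have := fibSS t.+1; lia.
  exists (2 * k + t.+1).+1.
  have -> : q t.+2 = (nth (0, LB) (block k t.+1) t).1.
    by rewrite -(nthq t.+1 t.+1) //= (nth_map (0, LB)).
  have -> : golden t.+1 = (nth (0, LB) (block k t.+1) t).2.
    rewrite -(@golden_prefix t.+2) //; last first.
      by rewrite (gstring_block k) size_rcons size_map; lia.
    by rewrite (gstring_block k) nth_rcons size_map lt (nth_map (0, LB)).
  exact/block_zrep/In_nth.
split=> [[|[|t]]|[|[|t]]] // _.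
- by rewrite subn1 /=; have [N /(zrep_Z hk)] := qSS t.
- by rewrite q1; case: B2k => f0 _; apply: zrep_min f0 (zrep_2k hk).
- have [m0 _] : B k (q t.+2) by apply/hq.2; exists t.+2.
  by have [N] := qSS t; apply: zrep_min.
Qed.
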